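(* Let $2s\in\{1,2,3,\dots\}$ and let $\mathsf R'$ be a $U_q(sl_2)$-invariant operator on $V_s\otimes V_s$ with spectral resolution $$\mathsf R'=\sum_{k=0}^{2s} r_k\,\mathsf P^{2s-k},\qquad r_k\in\mathbb C,$$ which satisfies the Yang--Baxter equation in the braid group form $$\mathsf R'_{12}\,\mathsf R'_{23}\,\mathsf R'_{12}=\mathsf R'_{23}\,\mathsf R'_{12}\,\mathsf R'_{23}\quad\text{on } V_s^{\otimes 3}.$$ Let $$\mathsf R=\sum_{k=0}^{2s}\xi_k\,\mathsf P^{2s-k},\qquad \xi_k=(-1)^k q^{\rho(2s-k)-2\rho(s)},\qquad \rho(t)=t(t+1).$$ If $r_1\neq r_0$, then $\mathsf R'$ coincides with either $\mathsf R$ or $\mathsf R^{-1}$ up to normalization, i.e. there is a nonzero constant $c\in\mathbb C$ such that $\mathsf R'=c\,\mathsf R$ or $\mathsf R'=c\,\mathsf R^{-1}$.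
   Context: $q\in\mathbb C$ is nonzero and not a root of unity, with a fixed choice of $q^{1/2}$ (so that half-integer powers of $q$ are defined). Put $[t]=(q^t-q^{-t})/(q-q^{-1})$. $U_q(sl_2)$ is the algebra generated by $X^+,X^-,q^{H},q^{-H}$ with relations $[X^+,X^-]=\frac{q^{2H}-q^{-2H}}{q-q^{-1}}$, $q^HX^\pm=q^{\pm1}X^\pm q^H$, $q^{\pm H}q^{\mp H}=1$, and with coproduct $\Delta(X^\pm)=X^\pm\otimes q^{-H}+q^H\otimes X^\pm$, $\Delta(q^{\pm H})=q^{\pm H}\otimes q^{\pm H}$. For $2s\in\mathbb N$, $V_s$ is the irreducible module of dimension $2s+1$ with basis $\omega_k$, $k=-s,-s+1,\dots,s$, and action $\pi_s(X^\pm)\omega_k=\sqrt{[s\mp k][s\pm k+1]}\,\omega_{k\pm1}$, $\pi_s(q^{\pm H})\omega_k=q^{\pm k}\omega_k$ (with the same choice of square root for equal radicands). Then $V_s\otimes V_s=\bigoplus_{j=0}^{2s}V_j$ as a $U_q(sl_2)$-module (via $\Delta$), and $\mathsf P^j$ denotes the projector onto the irreducible submodule $V_j$ along this decomposition. An operator on $V_s\otimes V_s$ is $U_q(sl_2)$-invariant if it commutes with the action of $U_q(sl_2)$ via $\Delta$. For an operator $\mathsf O$ on $V_s\otimes V_s$, $\mathsf O_{12}=\mathsf O\otimes\mathrm{id}$ and $\mathsf O_{23}=\mathrm{id}\otimes\mathsf O$ on $V_s^{\otimes3}$. The operator $\mathsf R$ is the image in $V_s\otimes V_s$ of the Drinfeld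 universal R-matrix multiplied by the permutation operator; it satisfies the same Yang--Baxter equation. *)

(* Defs.v *)
(* Operators on F^d are matrices 'M_d acting on column vectors by A *m v, so
   that the matrix product is the composition of operators. *)
From HB Require Import structures.
From mathcomp Require Import all_boot all_order all_algebra.
From mathcomp Require Import reals complex mxtens.
From mathcomp Require Import ring lra zify.

Set Implicit Arguments.
Unset Strict Implicit.
Unset Printing Implicit Defensive.

Import Order.TTheory GRing.Theory Num.Theory.
Local Open Scope ring_scope.

Section Uq.
Variable F : fieldType.

Definition qnum (q : F) (t : int) : F := (q ^ t - q ^ (- t)) / (q - q^-1).

Inductive uq_gen := Xp | Xm | qH | qHi.

(* Elements of U_q(sl_2), given by representatives in the free algebra: a list
   of scalar-word pairs stands for the linear combination of the words. *)
Definition uq : Type := seq (F * seq uq_gen).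

Definition uq_action (d : nat) := uq_gen -> 'M[F]_d.

(* The action of an arbitrary element; it depends only on the class of the
   representative when [uq_module] below holds. *)
Definition act d (pi : uq_action d) (a : uq) : 'M[F]_d :=
  \sum_(m <- a) m.1 *: \big[mulmx/1%:M]_(g <- m.2) pi g.

Definition uq_module (q : F) d (pi : uq_action d) : Prop :=
  [/\ pi Xp *m pi Xm - pi Xm *m pi Xp
        = (q - q^-1)^-1 *: (pi qH *m pi qH - pi qHi *m pi qHi),
      pi qH *m pi Xp = q *: (pi Xp *m pi qH),
      pi qH *m pi Xm = q^-1 *: (pi Xm *m pi qH),
      pi qH *m pi qHi = 1%:M
    & pi qHi *m pi qH = 1%:M].

(* V_s with n = 2s.  The index i : 'I_n.+1 stands for the basis vector omega_k
   with k = i - n/2, so that s - k = n - i, s + k = i, and q^k = qh^(2i - n)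
   where qh is the chosen square root of q. *)
Definition spin (q qh : F) (sqrt : F -> F) (n : nat) : uq_action n.+1 :=
  fun g => match g with
  | Xp => \matrix_(i, j) (if i == j.+1 :> nat then
            sqrt (qnum q (n%:Z - j%:Z) * qnum q (j%:Z + 1)) else 0)
  | Xm => \matrix_(i, j) (if i.+1 == j :> nat then
            sqrt (qnum q j%:Z * qnum q (n%:Z - j%:Z + 1)) else 0)
  | qH => \matrix_(i, j) (if i == j then qh ^ (2 * j%:Z - n%:Z) else 0)
  | qHi => \matrix_(i, j) (if i == j then qh ^ (- (2 * j%:Z - n%:Z)) else 0)
  end.

Definition tensor d1 d2 (pi1 : uq_action d1) (pi2 : uq_action d2) :
    uq_action (d1 * d2) :=
  fun g => match g with
  | Xp => pi1 Xp *t pi2 qHi + pi1 qH *t pi2 Xp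
  | Xm => pi1 Xm *t pi2 qHi + pi1 qH *t pi2 Xm
  | qH => pi1 qH *t pi2 qH
  | qHi => pi1 qHi *t pi2 qHi
  end.

Definition uq_hom d1 d2 (pi1 : uq_action d1) (pi2 : uq_action d2)
    (f : 'M[F]_(d2, d1)) : Prop :=
  forall a : uq, f *m act pi1 a = act pi2 a *m f.

Definition uq_invariant d (pi : uq_action d) (A : 'M[F]_d) : Prop :=
  uq_hom pi pi A.

Definition uq_submodule d (pi : uq_action d) (U : {vspace 'cV[F]_d}) : Prop :=
  forall (a : uq) (v : 'cV[F]_d), v \in U -> act pi a *m v \in U.

(* The submodule U of (F^d, pi) is isomorphic to the module (F^e, pi'). *)
Definition uq_isomorphic d e (pi : uq_action d) (U : {vspace 'cV[F]_d})
    (pi' : uq_action e) : Prop :=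
  exists f : 'M[F]_(d, e),
    [/\ uq_hom pi' pi f,
        (forall v : 'cV[F]_e, f *m v = 0 -> v = 0)
      & (forall u : 'cV[F]_d, u \in U <-> exists v : 'cV[F]_e, u = f *m v)].

Definition spin2 (q qh : F) (sqrt : F -> F) (n : nat) :
    uq_action (n.+1 * n.+1) :=
  tensor (spin q qh sqrt n) (spin q qh sqrt n).

(* V_s (x) V_s is the direct sum of submodules W j isomorphic to V_j, for
   0 <= j <= n = 2s; the integral spin j corresponds to the index 2j in spin. *)
Definition spin2_decomposition (q qh : F) (sqrt : F -> F) (n : nat)
    (W : nat -> {vspace 'cV[F]_(n.+1 * n.+1)}) : Prop :=
  [/\ (forall j, (j <= n)%N ->
         uq_submodule (spin2 q qh sqrt n) (W j) /\
         uq_isomorphic (spin2 q qh sqrt n) (W j) (spin q qh sqrt j.*2)),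
      directv (\sum_(j < n.+1) W j)%VS
    & (\sum_(j < n.+1) W j)%VS = fullv].

Definition projectors d (n : nat) (W : nat -> {vspace 'cV[F]_d})
    (P : nat -> 'M[F]_d) : Prop :=
  forall j, (j <= n)%N ->
    (forall v, v \in W j -> P j *m v = v) /\
    (forall i v, (i <= n)%N -> i != j -> v \in W i -> P j *m v = 0).

(* O_12 and O_23 on the triple tensor product, bracketed as (V (x) V) (x) V. *)
Definition op12 d (A : 'M[F]_(d * d)) : 'M[F]_(d * d * d) := A *t (1%:M : 'M_d).
Definition op23 d (A : 'M[F]_(d * d)) : 'M[F]_(d * d * d) :=
  castmx (mulnA d d d, mulnA d d d) ((1%:M : 'M_d) *t A).

Definition yang_baxter d (A : 'M[F]_(d * d)) : Prop :=
  op12 A *m op23 A *m op12 A = op23 A *m op12 A *m op23 A.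

(* With s = n/2 and rho(t) = t(t+1),
   2 (rho(n - k) - 2 rho(s)) = 2 (n - k)(n - k + 1) - n (n + 2),
   whence the exponent of qh = q^(1/2). *)
Definition xi (qh : F) (n k : nat) : F :=
  (-1) ^+ k * qh ^ ((2 * ((n - k) * (n - k).+1))%:Z - (n * n.+2)%:Z).

Definition Rmatrix d (qh : F) (n : nat) (P : nat -> 'M[F]_d) : 'M[F]_d :=
  \sum_(k < n.+1) xi qh n k *: P (n - k)%N.

End Uq.

Arguments spin2_decomposition {F} q qh sqrt n W.
Arguments projectors {F d} n W P.

Lemma tensor_uq_module (F : fieldType) (q : F) d1 d2
    (pi1 : uq_action F d1) (pi2 : uq_action F d2) :
  q != 0 -> uq_module q pi1 -> uq_module q pi2 -> uq_module q (tensor pi1 pi2).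
Proof.
move=> q0 [c1 p1 m1 k1 l1] [c2 p2 m2 k2 l2].
have cv d (K X L : 'M[F]_d) (c : F) : c != 0 -> L *m K = 1%:M -> K *m L = 1%:M ->
    K *m X = c *: (X *m K) -> X *m L = c *: (L *m X).
  move=> c0 lk kl e; rewrite -[X in X *m L]mul1mx -lk -!mulmxA (mulmxA K X) e.
  by rewrite -!scalemxAl -scalemxAr -mulmxA kl mulmx1.
have tD1 m n p r (A A' : 'M[F]_(m, n)) (B : 'M[F]_(p, r)) :
    (A + A') *t B = A *t B + A' *t B.
  by apply/matrixP=> i j; rewrite !mxE mulrDl.
have tD2 m n p r (A : 'M[F]_(m, n)) (B B' : 'M[F]_(p, r)) :
    A *t (B + B') = A *t B + A *t B'.
  by apply/matrixP=> i j; rewrite !mxE mulrDr.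
have tZ1 m n p r c (A : 'M[F]_(m, n)) (B : 'M[F]_(p, r)) :
    (c *: A) *t B = c *: (A *t B).
  by apply/matrixP=> i j; rewrite !mxE mulrA.
have tZ2 m n p r c (A : 'M[F]_(m, n)) (B : 'M[F]_(p, r)) :
    A *t (c *: B) = c *: (A *t B).
  by apply/matrixP=> i j; rewrite !mxE mulrCA.
have tN1 m n p r (A : 'M[F]_(m, n)) (B : 'M[F]_(p, r)) :
    (- A) *t B = - (A *t B).
  by apply/matrixP=> i j; rewrite !mxE mulNr.
have tN2 m n p r (A : 'M[F]_(m, n)) (B : 'M[F]_(p, r)) :
    A *t (- B) = - (A *t B).
  by apply/matrixP=> i j; rewrite !mxE mulrN.
have t1 : (1%:M : 'M[F]_d1) *t (1%:M : 'M[F]_d2) = 1%:M.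
  apply/matrixP=> i j; case: (mxtens_indexP i) => i1 i2.
  case: (mxtens_indexP j) => j1 j2; rewrite tensmxE !mxE.
  by rewrite (inj_eq (can_inj (@mxtens_indexK _ _))) xpair_eqE -natrM mulnb.
have qv0 : q^-1 != 0 by rewrite invr_eq0.
have p2' := cv _ _ _ _ _ q0 l2 k2 p2.
have m2' := cv _ _ _ _ _ qv0 l2 k2 m2.
split=> /=; last by rewrite tensmx_mul l1 l2.
- rewrite !(mulmxDl, mulmxDr) !tensmx_mul p1 m1 p2' m2' !tZ1 !tZ2 !scalerA.
  rewrite mulfV // mulVf // !scale1r.
  set A := (_ *m pi1 Xm) *t (pi2 qHi *m pi2 qHi).
  set D := _ *t (pi2 Xp *m pi2 Xm).
  set A' := (_ *m pi1 Xp) *t (pi2 qHi *m pi2 qHi).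
  set D' := _ *t (pi2 Xm *m pi2 Xp).
  set B := _ *t (pi2 qHi *m pi2 Xm); set C := _ *t (pi2 qHi *m pi2 Xp).
  have -> : A + B + (C + D) - (A' + C + (B + D')) = (A - A') + (D - D').
    by apply/matrixP=> i j; rewrite !mxE; ring.
  rewrite /A /A' /D /D' -tN1 -tD1 -tN2 -tD2 c1 c2 tZ1 tZ2 -scalerDr.
  by rewrite tD1 tD2 tN1 tN2; congr (_ *: _); rewrite [LHS]addrC addrA subrK.
- by rewrite mulmxDl mulmxDr !tensmx_mul p1 p2 k2 l2 !tZ1 !tZ2 scalerDr.
- by rewrite mulmxDl mulmxDr !tensmx_mul m1 m2 k2 l2 !tZ1 !tZ2 scalerDr.
- by rewrite tensmx_mul k1 k2.
Qed.

Lemma spin_uq_module (F : fieldType) (q qh : F) (sqrt : F -> F) (n : nat) :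
  q != 0 -> q ^+ 2 != 1 -> qh ^+ 2 = q -> (forall x, sqrt x ^+ 2 = x) ->
  uq_module q (spin q qh sqrt n).
Proof.
move=> q0 q21 qhq sq.
have qh0 : qh != 0 by apply: contra_neq q0 => h; rewrite -qhq h expr0n.
have [s0 n0] : sqrt 0 = 0 /\ qnum q 0 = 0.
  split; last by rewrite /qnum oppr0 subrr mul0r.
  by apply/eqP; have /eqP := sq 0; rewrite expf_eq0.
have diagl (f : 'I_n.+1 -> F) (A : 'M[F]_n.+1) i j :
    ((\matrix_(i, j) (if i == j then f j else 0)) *m A) i j = f i * A i j.
  rewrite mxE (bigD1 i) //= mxE eqxx big1 ?addr0 // => k ki.
  by rewrite mxE eq_sym (negPf ki) mul0r.
have diagr (f : 'I_n.+1 -> F) (A : 'M[F]_n.+1) i j :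
    (A *m (\matrix_(i, j) (if i == j then f j else 0))) i j = A i j * f j.
  rewrite mxE (bigD1 j) //= mxE eqxx big1 ?addr0 // => k kj.
  by rewrite mxE (negPf kj) mulr0.
have hz (t : int) : qh ^ (2 * t) = q ^ t by rewrite -exprz_exp -exprnP qhq.
split; apply/matrixP=> i j.
- have pm (a b : 'I_n.+1) : (spin q qh sqrt n Xp *m spin q qh sqrt n Xm) a b
      = if a == b then qnum q b%:Z * qnum q (n%:Z - b%:Z + 1) else 0.
    rewrite mxE; have [b0|b0] := posnP b.
      rewrite big1 => [|k _]; last by rewrite !mxE b0 mulr0.
      by rewrite b0 n0 mul0r if_same.
    have bn : (b.-1 < n.+1)%N by have := ltn_ord b; lia.
    rewrite (bigD1 (Ordinal bn)) //= !mxE /= prednK // eqxx big1 => [|k kb].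
      rewrite addr0; case: eqP => [ab|ab].
        rewrite (_ : (b.-1)%:Z = b%:Z - 1); last lia.
        rewrite ifT; last by apply/eqP/val_inj.
        rewrite subrK opprB addrA addrAC [X in sqrt X * _]mulrC.
        by rewrite -expr2 sq.
      by rewrite mul0r ifF //; apply/eqP=> e; apply: ab; rewrite e.
    rewrite !mxE; case: (k.+1 =P b :> nat) => [e|]; last by rewrite mulr0.
    by case/eqP: kb; apply: val_inj; rewrite /= -e.
  have mp (a b : 'I_n.+1) : (spin q qh sqrt n Xm *m spin q qh sqrt n Xp) a b
      = if a == b then qnum q (n%:Z - b%:Z) * qnum q (b%:Z + 1) else 0.
    rewrite mxE; have [bn|bn] := leqP n b.
      have bE : b = n :> nat by have := ltn_ord b; lia.
      rewrite big1 => [|k _].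
        by rewrite bE subrr n0 mul0r if_same.
      rewrite !mxE bE [X in _ * X]ifF ?mulr0 //.
      by apply/eqP; have := ltn_ord k; lia.
    have b1 : (b.+1 < n.+1)%N by [].
    rewrite (bigD1 (Ordinal b1)) //= !mxE /= eqxx eqSS big1 => [|k kb].
      rewrite addr0; case: eqP => [ab|ab].
        rewrite ifT; last by apply/eqP/val_inj.
        rewrite (_ : (b.+1)%:Z = b%:Z + 1); last lia.
        rewrite opprD addrA subrK [X in sqrt X * _]mulrC.
        by rewrite -expr2 sq.
      by rewrite mul0r ifF //; apply/eqP=> e; apply: ab; rewrite e.
    rewrite !mxE; case: (k =P b.+1 :> nat) => [e|]; last by rewrite mulr0.
    by case/eqP: kb; apply: val_inj; rewrite /= -e.
  have sub (A B : 'M[F]_n.+1) : (A - B) i j = A i j - B i j by rewrite !mxE.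
  rewrite sub pm mp [RHS]mxE sub !diagl !mxE; case: eqP => [->|_]; last first.
    by rewrite !mulr0 subrr mulr0.
  set x : int := j%:Z; set m : int := n%:Z.
  have e2 y : qh ^ y * qh ^ y = q ^ y.
    by rewrite -expfzDr // -hz; congr (_ ^ _); lia.
  rewrite !e2.
  have qd : q - q^-1 != 0.
    apply: contra_neq q21 => /eqP; rewrite subr_eq0 => /eqP e.
    by rewrite expr2 {1}e mulVf.
  have qz t : q ^ t != 0 by rewrite expfz_neq0.
  rewrite /qnum -!invr_expz !expfzDr // -!invr_expz !expr1z.
  rewrite (mulrC 2 x) mulr_natr mulr2n !expfzDr //.
  have := qz x; have := qz m; move: (q ^ x) (q ^ m) => u v v0 u0.
  by field; rewrite v0 u0 q0 -expr2 subr_eq0.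
- rewrite diagl [RHS]mxE diagr !mxE; case: eqP => [->|_];
    last by rewrite !(mulr0, mul0r).
  move: (sqrt _) => S; rewrite mulrCA [LHS]mulrC; congr (_ * _).
  by rewrite -[q in RHS]expr1z  -hz -expfzDr //; congr (_ ^ _); lia.
- rewrite diagl [RHS]mxE diagr !mxE; case: eqP => [<-|_];
    last by rewrite !(mulr0, mul0r).
  move: (sqrt _) => S; rewrite mulrCA [LHS]mulrC; congr (_ * _).
  by rewrite -[q in RHS]expr1z invr_expz -hz -expfzDr //; congr (_ ^ _); lia.
- by rewrite diagl !mxE; case: eqP => [->|_]; rewrite ?mulr0 // -expfzDr // subrr.
- by rewrite diagl !mxE; case: eqP => [->|_]; rewrite ?mulr0 // -expfzDr // addNr.
Qed.

(* Main.v *)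
(* Write e_0, ..., e_n for the basis of V_s from the lowest weight up (n = 2s).
   The Casimir element is a symmetric matrix with distinct eigenvalues on the
   summands of V_s (x) V_s, so R' is symmetric and has the lowest weight vector
   of total level k as eigenvector for r_k.  The Yang-Baxter equation at total
   level 1, with r_1 <> r_0, says that R' maps e_0 (x) e_1 to a multiple of
   e_1 (x) e_0, or e_1 (x) e_0 to a multiple of e_0 (x) e_1.  In the first case
   X^- forces R'(e_0 (x) e_m) into the line of e_m (x) e_0 up to a multiple of
   the lowest weight vector of level m, and two entries of the Yang-Baxter
   equation, combined with the symmetry of R', force that multiple to vanish, by
   induction on m.  Pairing the lowest weight vector of level k with
   e_0 (x) e_k then gives r_k, and the answer is that of R.  The second case is
   the image of the first under exchanging the tensor factors and q with q^-1,
   and gives R^-1. *)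
Require Import Defs.
From mathcomp Require Import all_boot all_order all_algebra.
From mathcomp Require Import reals complex mxtens.
From mathcomp Require Import ring zify.
Set Implicit Arguments.
Unset Strict Implicit.
Unset Printing Implicit Defensive.
Import Order.TTheory GRing.Theory Num.Theory.
Local Open Scope ring_scope.

(** * Columns of the vectors [e_0 (x) e_m] under the braid relation *)

(* [t a b i j] is the coefficient of e_a (x) e_b in R'(e_i (x) e_j), [kap i] and
   [x i] are the coefficients of q^H e_i and of X^- e_i. *)
Section Shift.
Variables (F : fieldType) (n : nat) (x kap : nat -> F).
Variable t : nat -> nat -> nat -> nat -> F.
Hypothesis n_gt0 : (0 < n)%N.
Hypothesis x_neq0 : forall i, (0 < i <= n)%N -> x i != 0.
Hypothesis kap_neq0 : forall i, kap i != 0.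
Hypothesis t_wt : forall a b i j, (a <= n)%N -> (b <= n)%N -> (i <= n)%N ->
  (j <= n)%N -> (a + b != i + j)%N -> t a b i j = 0.
Hypothesis t_sym : forall a b i j, t a b i j = t i j a b.
Hypothesis t_low : forall a b j, (a < n)%N -> (b < n)%N -> (j < n)%N ->
  kap 0 * x j.+1 * t a b 0 j =
  x a.+1 / kap b * t a.+1 b 0 j.+1 + kap a * x b.+1 * t a b.+1 0 j.+1.
Hypothesis t_braid : forall a b c i j k, (a <= n)%N -> (b <= n)%N ->
  (c <= n)%N -> (i <= n)%N -> (j <= n)%N -> (k <= n)%N ->
  \sum_(u < n.+1) \sum_(v < n.+1) \sum_(w < n.+1)
    t u v i j * t w c v k * t a b u w =
  \sum_(u < n.+1) \sum_(v < n.+1) \sum_(w < n.+1)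
    t u v j k * t a w i u * t b c w v.
Hypothesis t0101 : t 0 1 0 1 = 0.
Hypothesis t1001 : t 1 0 0 1 != 0.

Lemma sum_ord_only (G : nat -> F) k : (k <= n)%N ->
  (forall i, (i <= n)%N -> i != k -> G i = 0) -> \sum_(i < n.+1) G i = G k.
Proof.
move=> kn G0; rewrite (bigD1 (Ordinal (kn : (k < n.+1)%N))) //= big1 ?addr0 //.
by move=> i ik; apply: G0; rewrite // -ltnS.
Qed.

Lemma sum_ord_two (G : nat -> F) k l : (k <= n)%N -> (l <= n)%N -> k != l ->
  (forall i, (i <= n)%N -> i != k -> i != l -> G i = 0) ->
  \sum_(i < n.+1) G i = G k + G l.
Proof.
move=> kn ln kl G0; rewrite (bigD1 (Ordinal (kn : (k < n.+1)%N))) //=.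
rewrite (bigD1 (Ordinal (ln : (l < n.+1)%N))) /=; last by rewrite eq_sym.
rewrite big1 ?addr0 // => i /andP[ik il].
by apply: G0; rewrite // -ltnS.
Qed.

(** This coefficient is the one obstruction in passing from level [m] to [m.+1]. If it were nonzero,
    [t_low] would make the column of [e_0 (x) e_(m+1)] nonzero at every [a <= m]; one braid entry
    then forces [t m.+1 0 1 m = 0], and this leaves a second entry equating a product of nonzero
    factors with 0. *)
Lemma extremal_coef_eq0 m : (0 < m)%N -> (m < n)%N ->
  (forall i a b, (i <= m)%N -> (a <= n)%N -> (b <= n)%N ->
     (a != i) || (b != 0) -> t a b 0 i = 0) ->
  t 0 m.+1 0 m.+1 = 0.
Proof.
move=> m0 mn IH; apply/eqP/negPn/negP => w0.
(* By [IH] the left side of [t_low] vanishes, so consecutive coefficients of the column are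
   proportional with nonzero factors. *)
have w_neq0 a : (a <= m)%N -> t a (m.+1 - a) 0 m.+1 != 0.
  elim: a => [|a IHa] am; first by rewrite subn0.
  have := @t_low a (m - a) m; rewrite IH; try lia.
  rewrite mulr0 subSS -subSn; last lia.
  move=> E; apply: contraNneq (mulf_neq0 (mulf_neq0 (kap_neq0 a)
    (@x_neq0 (m.+1 - a) _)) (IHa _)) => [wa| |]; try lia.
  by rewrite wa mulr0 add0r in E; rewrite -E //; lia.
have t0110 : t 0 1 1 0 != 0 by rewrite t_sym.
(* Braid relation on e_0 (x) e_1 (x) e_m, coefficient of e_m (x) e_0 (x) e_1. *)
have u0 : t m.+1 0 1 m = 0.
  have := @t_braid m 0 1 0 1 m; rewrite [X in X = _]big1; last first.
    move=> u _; apply: big1 => v _; apply: big1 => w _.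
    have [un vn wn] : [/\ (u <= n)%N, (v <= n)%N & (w <= n)%N].
      by rewrite !leq_ord.
    have [v0|v0] := eqVneq (v : nat) 0; last first.
      by rewrite (IH 1 u v) ?mul0r ?v0 ?orbT //; lia.
    by rewrite v0 (IH m w 1) ?orbT ?mulr0 ?mul0r //; lia.
  rewrite (@sum_ord_only (fun u => \sum_(v < n.+1) \sum_(w < n.+1)
    t u v 1 m * t m w 0 u * t 0 1 w v) m.+1) //; last first.
    move=> u un um; apply: big1 => v _; apply: big1 => w _.
    have [vn wn] : (v <= n)%N /\ (w <= n)%N by rewrite !leq_ord.
    have [uv|uv] := eqVneq (u + v)%N (1 + m)%N; last first.
      by rewrite t_wt ?mul0r //; lia.
    have [/andP[/eqP um' /eqP w0']|mw] := boolP ((m == u) && (w == 0 :> nat)).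
      have -> : v = 1%N :> nat by lia.
      by rewrite w0' t0101 mulr0.
    by rewrite (IH u m w) ?mulr0 ?mul0r //; lia.
  rewrite (@sum_ord_only (fun v => \sum_(w < n.+1)
    t m.+1 v 1 m * t m w 0 m.+1 * t 0 1 w v) 0) //; last first.
    move=> v vn v0; apply: big1 => w _; rewrite t_wt ?mul0r //; lia.
  rewrite (@sum_ord_only (fun w => t m.+1 0 1 m * t m w 0 m.+1 * t 0 1 w 0) 1);
    try lia; last first.
    move=> w wn w1; rewrite [t 0 1 w 0]t_wt ?mulr0 //; lia.
  have wm := w_neq0 m (leqnn _).
  rewrite subSnn in wm => /(_ _ _ _ _ _ _)/esym/eqP.
  by rewrite !mulf_eq0 (negPf wm) (negPf t0110) !orbF => H; apply/eqP/H; lia.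
(* As [t 0 1 0 1 = 0], [t_low] at the origin makes [t 0 0 0 0] a nonzero multiple of [t 1 0 0 1]. *)
have r0 : t 0 0 0 0 != 0.
  have := @t_low 0 0 0 n_gt0 n_gt0 n_gt0; rewrite t0101 mulr0 addr0 => E.
  apply: contraTneq t1001 => r0; move/eqP: E; rewrite r0 mulr0 eq_sym.
  rewrite !mulf_eq0 invr_eq0 (negPf (kap_neq0 0)) (negPf (@x_neq0 1 n_gt0)) /=.
  by move=> ->.
(* Braid relation on e_0 (x) e_0 (x) e_(m+1), coefficient of
   e_0 (x) e_1 (x) e_m. *)
have := @t_braid 0 1 m 0 0 m.+1; rewrite [X in X = _]big1; last first.
  move=> u _; apply: big1 => v _; apply: big1 => w _.
  have [un vn wn] : [/\ (u <= n)%N, (v <= n)%N & (w <= n)%N].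
    by rewrite !leq_ord.
  have [uv|uv] := eqVneq (u + v)%N 0; last first.
    by rewrite (t_wt un vn) ?mul0r //; lia.
  have [-> ->] : u = 0 :> nat /\ v = 0 :> nat by lia.
  have [->|w1] := eqVneq (w : nat) 1%N; first by rewrite t0101 mulr0.
  by rewrite (@t_wt 0 1 0 w) ?mulr0 //; lia.
rewrite (@sum_ord_two (fun u => \sum_(v < n.+1) \sum_(w < n.+1)
  t u v 0 m.+1 * t 0 w 0 u * t 1 m w v) 0 m.+1) //; last first.
  move=> u un u0' um; apply: big1 => v _; apply: big1 => w _.
  have [vn wn] : (v <= n)%N /\ (w <= n)%N by rewrite !leq_ord.
  have [uv|uv] := eqVneq (u + v)%N (0 + m.+1)%N; last first.
    by rewrite t_wt ?mul0r //; lia.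
  by rewrite (IH u 0 w) ?mulr0 ?mul0r //; lia.
rewrite (@sum_ord_only (fun v => \sum_(w < n.+1)
  t 0 v 0 m.+1 * t 0 w 0 0 * t 1 m w v) m.+1) //; last first.
  move=> v vn v0; apply: big1 => w _; rewrite t_wt ?mul0r //; lia.
rewrite (@sum_ord_only (fun w =>
  t 0 m.+1 0 m.+1 * t 0 w 0 0 * t 1 m w m.+1) 0); try lia; last first.
  move=> w wn w1; rewrite [t 0 w 0 0]t_wt ?mulr0 ?mul0r //; lia.
(* The term [u = m.+1] carries the factor [t 1 m m.+1 0], which is zero by [u0] and [t_sym]. *)
rewrite [X in _ + X]big1; last first.
  move=> v _; apply: big1 => w _.
  have [vn wn] : (v <= n)%N /\ (w <= n)%N by rewrite !leq_ord.
  have [v0|v0] := eqVneq (v : nat) 0; last by rewrite t_wt ?mul0r //; lia.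
  have [->|wm] := eqVneq (w : nat) m.+1; last first.
    by rewrite (@t_wt 0 w) ?mulr0 ?mul0r //; lia.
  by rewrite v0 [t 1 m _ _]t_sym u0 mulr0.
have w1 := w_neq0 1%N m0; rewrite subSS subn0 in w1.
rewrite addr0 => /(_ _ _ _ _ _ _)/esym/eqP.
rewrite !mulf_eq0 (negPf w1) (negPf w0) (negPf r0) => H.
by suff: false by []; apply: H; lia.
Qed.

(** Each level multiplies the surviving coefficient by [kap 0 ^+ 2], as [t_low] at [a = m], [b = 0]
    shows. Keeping [t] and [kap] abstract lets the result serve both for the operator and for its
    mirror image. *)
Lemma extremal_column m a b : (m <= n)%N -> (a <= n)%N -> (b <= n)%N ->
  t a b 0 m = if (a == m) && (b == 0) then kap 0 ^+ (2 * m) * t 0 0 0 0 else 0.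
Proof.
elim/ltn_ind: m a b => m IH a b mn an bn.
have [m0|m0] := posnP m.
  rewrite m0 muln0 expr0 mul1r; case: ifP => [/andP[/eqP-> /eqP->]//|ab].
  by rewrite t_wt //; lia.
case: m => // m in IH mn m0 *.
(* Level 1 is the hypothesis [t0101]; [extremal_coef_eq0] requires [0 < m]. *)
have tm : t 0 m.+1 0 m.+1 = 0.
  have [->//|m1] := posnP m.
  apply: extremal_coef_eq0 => // i a' b' im an' bn' ab.
  by rewrite IH // ?ifN //; lia.
have [ab|ab] := eqVneq (a + b)%N m.+1; last first.
  by rewrite t_wt // ifN //; lia.
(* The left side of [t_low] is again zero, so the zero at [c = 0] propagates along the column up to
   [c = m]. *)
have w_eq0 c : (c <= m)%N -> t c (m.+1 - c) 0 m.+1 = 0.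
  elim: c => [|c IHc] cm; first by rewrite subn0.
  have := @t_low c (m - c) m; rewrite IH ?ifN; try lia.
  rewrite mulr0 -subSn; last lia.
  rewrite IHc; last lia.
  rewrite mulr0 addr0 subSS => /(_ _ _ _)/esym/eqP.
  rewrite !mulf_eq0 invr_eq0 (negPf (kap_neq0 _)) orbF.
  by rewrite (negPf (@x_neq0 c.+1 _)) /= => [H|]; [apply/eqP/H|]; lia.
case: ifP => [/andP[/eqP-> /eqP->]|]; last first.
  by move=> h; have -> : b = (m.+1 - a)%N; [lia | rewrite w_eq0 //; lia].
have := @t_low m 0 m; rewrite IH ?eqxx //; try lia.
have := w_eq0 m (leqnn _); rewrite subSnn => ->.
rewrite mulr0 addr0 /= => /(_ _ _ _).
have x0 := @x_neq0 m.+1 mn; have k0 := kap_neq0 0 => E.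
apply: (mulfI (mulf_neq0 x0 (invr_neq0 k0))); rewrite -E; try lia.
rewrite (_ : (2 * m.+1 = (2 * m).+2)%N); last lia.
rewrite !exprS; move: (kap 0 ^+ _) => K; by field.
Qed.
End Shift.

(** * The Yang-Baxter equation in coordinates *)

Lemma sum_mxtens (V : nmodType) m n (G : 'I_(m * n) -> V) :
  \sum_p G p = \sum_(i < m) \sum_(j < n) G (mxtens_index (i, j)).
Proof.
rewrite pair_big /=; apply: reindex.
exists (@mxtens_unindex m n) => p _; last exact: mxtens_unindexK.
by case: p => i j; exact: mxtens_indexK.
Qed.

Section Braid.
Variables (F : fieldType) (d : nat) (A : 'M[F]_(d * d)).
Notation I2 a b := (mxtens_index (a, b)).

Lemma op12E (a b c i j k : 'I_d) :
  op12 A (I2 (I2 a b) c) (I2 (I2 i j) k) = A (I2 a b) (I2 i j) * (c == k)%:R.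
Proof. by rewrite /op12 tensmxE !mxE. Qed.

Lemma op23E (a b c i j k : 'I_d) :
  op23 A (I2 (I2 a b) c) (I2 (I2 i j) k) = (a == i)%:R * A (I2 b c) (I2 j k).
Proof.
(* Both bracketings number a triple by the same integer, so the cast in [op23] only reassociates
   indices. *)
have castE (u v w : 'I_d) :
    cast_ord (esym (mulnA d d d)) (I2 (I2 u v) w) = I2 u (I2 v w).
  by apply: val_inj => /=; rewrite mulnDl mulnA addnA.
by rewrite /op23 castmxE !castE tensmxE !mxE.
Qed.

Lemma op12_mulmxE (M : 'M[F]_(d * d * d)) (a b c : 'I_d) p :
  (op12 A *m M) (I2 (I2 a b) c) p =
  \sum_u \sum_v A (I2 a b) (I2 u v) * M (I2 (I2 u v) c) p.
Proof.
rewrite mxE sum_mxtens sum_mxtens; apply: eq_bigr => u _; apply: eq_bigr => v _.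
rewrite (bigD1 c) //= big1 => [|w wc]; first by rewrite op12E eqxx mulr1 addr0.
by rewrite op12E eq_sym (negPf wc) mulr0 mul0r.
Qed.

Lemma op23_mulmxE (M : 'M[F]_(d * d * d)) (a b c : 'I_d) p :
  (op23 A *m M) (I2 (I2 a b) c) p =
  \sum_u \sum_v A (I2 b c) (I2 u v) * M (I2 (I2 a u) v) p.
Proof.
rewrite mxE sum_mxtens sum_mxtens (bigD1 a) //= [X in _ + X = _]big1 => [|w wa];
  last first.
  apply: big1 => v _; apply: big1 => k _.
  by rewrite op23E eq_sym (negPf wa) !mul0r.
rewrite addr0; apply: eq_bigr => u _; apply: eq_bigr => v _.
by rewrite op23E eqxx mul1r.
Qed.

(** Each side sums over paths from [(i, j, k)] to [(a, b, c)]: the factors of a summand, from left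
    to right, are three successive moves on adjacent tensor factors, with intermediate indices [u],
    [v], [w]. *)
Lemma yang_baxterE (a b c i j k : 'I_d) : yang_baxter A ->
  \sum_u \sum_v \sum_w
    A (I2 u v) (I2 i j) * A (I2 w c) (I2 v k) * A (I2 a b) (I2 u w) =
  \sum_u \sum_v \sum_w
    A (I2 u v) (I2 j k) * A (I2 a w) (I2 i u) * A (I2 b c) (I2 w v).
Proof.
move=> /(congr1 (fun M : 'M_(d * d * d) => M (I2 (I2 a b) c) (I2 (I2 i j) k))).
rewrite -!mulmxA op12_mulmxE op23_mulmxE => E.
have LE : \sum_u \sum_v \sum_w
    A (I2 u v) (I2 i j) * A (I2 w c) (I2 v k) * A (I2 a b) (I2 u w) =
   \sum_u \sum_v A (I2 a b) (I2 u v) *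
     (op23 A *m op12 A) (I2 (I2 u v) c) (I2 (I2 i j) k).
  apply: eq_bigr => u _; rewrite exchange_big; apply: eq_bigr => w _.
  rewrite op23_mulmxE mulr_sumr; apply: eq_bigr => v _.
  rewrite (bigD1 k) //= big1 => [|l lk].
    by rewrite op12E eqxx mulr1 addr0; ring.
  by rewrite op12E (negPf lk) !mulr0.
rewrite LE E.
transitivity (\sum_w \sum_v \sum_u
  A (I2 u v) (I2 j k) * A (I2 a w) (I2 i u) * A (I2 b c) (I2 w v)).
  apply: eq_bigr => w _; apply: eq_bigr => v _.
  rewrite op12_mulmxE mulr_sumr (bigD1 i) //= [X in _ + X]big1 => [|l li].
    rewrite addr0 mulr_sumr; apply: eq_bigr => u _.
    by rewrite op23E eqxx mul1r; ring.
  by rewrite big1 ?mulr0 // => u _; rewrite op23E (negPf li) mul0r mulr0.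
rewrite exchange_big /=; under eq_bigr do rewrite exchange_big /=.
by rewrite exchange_big.
Qed.
End Braid.

(** * Spectral projectors of an operator acting by distinct scalars on the summands *)

Section Projectors.
Variables (F : fieldType) (d n : nat).
Variables (W : nat -> {vspace 'cV[F]_d}) (P : nat -> 'M[F]_d).
Hypothesis W_full : (\sum_(j < n.+1) W j)%VS = fullv.
Hypothesis W_proj : projectors n W P.

Lemma eq_mulmx_sum (A B : 'M[F]_d) :
  (forall j v, (j <= n)%N -> v \in W j -> A *m v = B *m v) -> A = B.
Proof.
move=> AB; have {}AB (v : 'cV_d) : A *m v = B *m v.
  have /memv_sumP[u uW ->] : v \in (\sum_(j < n.+1) W j)%VS.
    by rewrite W_full memvf.
  rewrite !mulmx_sumr; apply: eq_bigr => j _.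
  by apply: (AB j); [rewrite leq_ord | exact: uW].
apply/matrixP => i j.
by have /matrixP/(_ i 0) := AB (delta_mx j 0); rewrite -!colE !mxE.
Qed.

Lemma projector_id j v : (j <= n)%N -> v \in W j -> P j *m v = v.
Proof. by move=> jn vW; have [-> ] := W_proj jn. Qed.

Lemma projector_zero i j v :
  (i <= n)%N -> (j <= n)%N -> i != j -> v \in W i -> P j *m v = 0.
Proof. by move=> iN jn ij vW; have [_ /(_ i)->] := W_proj jn. Qed.

Lemma projector_sum1 : \sum_(j < n.+1) P j = 1%:M.
Proof.
apply: eq_mulmx_sum => i v iN vW; rewrite mul1mx mulmx_suml.
rewrite (bigD1 (Ordinal (iN : (i < n.+1)%N))) //= projector_id //.
rewrite big1 ?addr0 // => j ji; apply: (projector_zero iN) => //.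
  by rewrite leq_ord.
by rewrite eq_sym.
Qed.

Lemma projectorM i j : (i <= n)%N -> (j <= n)%N ->
  P i *m P j = if i == j then P i else 0.
Proof.
move=> iN jn; apply: eq_mulmx_sum => k v kn vW; rewrite -mulmxA.
have [kj|kj] := eqVneq k j; last first.
  rewrite (projector_zero kn jn) // mulmx0; case: (eqVneq i j) => [->|_].
    by rewrite (projector_zero kn jn).
  by rewrite mul0mx.
rewrite kj in vW; rewrite (projector_id jn) //; case: (eqVneq i j) => [->|ij].
  by rewrite projector_id.
by rewrite mul0mx (projector_zero jn iN) // eq_sym.
Qed.

Variables (C : 'M[F]_d) (lam : nat -> F).
Hypothesis C_scalar :
  forall j v, (j <= n)%N -> v \in W j -> C *m v = lam j *: v.
Hypothesis lam_inj :
  forall i j, (i <= n)%N -> (j <= n)%N -> lam i = lam j -> i = j.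

Lemma mulmx_projector j : (j <= n)%N -> C *m P j = lam j *: P j.
Proof.
move=> jn; apply: eq_mulmx_sum => k v kn vW; rewrite -mulmxA -scalemxAl.
have [kj|kj] := eqVneq k j.
  by rewrite -kj projector_id // (C_scalar kn).
by rewrite (projector_zero kn jn) // mulmx0 scaler0.
Qed.

Lemma projector_mulmx j : (j <= n)%N -> P j *m C = lam j *: P j.
Proof.
move=> jn; apply: eq_mulmx_sum => k v kn vW; rewrite -mulmxA -scalemxAl.
rewrite (C_scalar kn) // -scalemxAr.
have [kj|kj] := eqVneq k j; first by rewrite kj.
by rewrite (projector_zero kn jn) // !scaler0.
Qed.

(** Applying [P j *m C = lam j *: P j] to [v] gives [(lam j - lam k) *: (P j *m v) = 0], so only
    [P k] survives. This locates [v] in its summand without an explicit description of [W]. *)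
Lemma projector_eigen k (v : 'cV_d) : (k <= n)%N -> C *m v = lam k *: v ->
  forall j, (j <= n)%N -> P j *m v = if j == k then v else 0.
Proof.
move=> kn Cv; have P0 j : (j <= n)%N -> j != k -> P j *m v = 0.
  move=> jn jk; have : lam j *: (P j *m v) = lam k *: (P j *m v).
    by rewrite scalemxAl -projector_mulmx // -mulmxA Cv scalemxAr.
  move/eqP; rewrite -subr_eq0 -scalerBl scaler_eq0 subr_eq0.
  case/orP => [/eqP/lam_inj e|/eqP//]; by rewrite e ?eqxx in jk.
move=> j jn; case: ifPn => [/eqP->|/P0->//].
rewrite -[RHS]mul1mx -projector_sum1 mulmx_suml.
rewrite (bigD1 (Ordinal (kn : (k < n.+1)%N))) //= big1 ?addr0 // => i ik.
by rewrite P0 // leq_ord.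
Qed.

(* Eigenspaces of a symmetric matrix for distinct eigenvalues are orthogonal,
   so each [P j] is an orthogonal projector. *)
Lemma projector_sym j : C^T = C -> (j <= n)%N -> (P j)^T = P j.
Proof.
move=> symC; have PtP i k : (i <= n)%N -> (k <= n)%N -> i != k ->
    (P i)^T *m P k = 0.
  move=> iN kn ik; have : lam i *: ((P i)^T *m P k) = lam k *: ((P i)^T *m P k).
    rewrite scalemxAl -linearZ /= -mulmx_projector // trmx_mul symC -mulmxA.
    by rewrite mulmx_projector // scalemxAr.
  move/eqP; rewrite -subr_eq0 -scalerBl scaler_eq0 subr_eq0.
  case/orP => [/eqP/lam_inj e|/eqP//]; by rewrite e ?eqxx in ik.
have PtPP i : (i <= n)%N -> (P i)^T = (P i)^T *m P i.
  move=> iN; rewrite -{1}[(P i)^T]mulmx1 -projector_sum1 mulmx_sumr.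
  rewrite (bigD1 (Ordinal (iN : (i < n.+1)%N))) //= big1 ?addr0 // => k ki.
  by rewrite PtP ?leq_ord // eq_sym.
move=> jn; have e := PtPP j jn.
by rewrite [LHS]e -[RHS]trmxK [in RHS]e trmx_mul trmxK.
Qed.
End Projectors.

(** * The modules V_s and their Casimir element *)

Section Spin.
Variables (F : fieldType) (q qh : F) (sqrt : F -> F).
Hypothesis q_neq0 : q != 0.
Hypothesis q_generic : forall m : nat, (0 < m)%N -> q ^+ m != 1.
Hypothesis qh_sqr : qh ^+ 2 = q.
Hypothesis sqrtK : forall y, sqrt y ^+ 2 = y.

Lemma qh_neq0 : qh != 0.
Proof. by apply: contra_neq q_neq0 => h; rewrite -qh_sqr h expr0n. Qed.

#[local] Hint Resolve qh_neq0 : core.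

Lemma expq_double (i : int) : qh ^ (2 * i) = q ^ i.
Proof. by rewrite -exprz_exp -exprnP qh_sqr. Qed.

Lemma expq_inj (i j : int) : q ^ i = q ^ j -> i = j.
Proof.
have W (a b : int) : a <= b -> q ^ a = q ^ b -> a = b.
  move=> ab E; apply/eqP; apply: contraT => nab.
  have := @q_generic `|b - a|%N; case/(_ _)/eqP; first by lia.
  rewrite exprnP gez0_abs; last lia.
  by rewrite expfzDr // -E -expfzDr // subrr.
by case: (leP i j) => [/W//|/ltW/W ji /esym/ji].
Qed.

Lemma qnum_neq0 (i : int) : i != 0 -> qnum q i != 0.
Proof.
move=> i0; rewrite mulf_neq0 ?invr_eq0 ?subr_eq0 //.
  by apply: contra_neq i0 => /expq_inj; lia.
rewrite -[X in X != _]expr1z -[X in _ != X]/(q ^ (- 1)).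
by apply/eqP => /expq_inj.
Qed.

Lemma sqrt_eq0 y : (sqrt y == 0) = (y == 0).
Proof. by rewrite -[in RHS](sqrtK y) expf_eq0. Qed.

(** The entry linking levels [i - 1] and [i], shared by [Xm] and [Xp]. Its zeros at [0] and [n.+1]
    later absorb indices that leave the basis. *)
Definition ladder (n i : nat) : F :=
  sqrt (qnum q i%:Z * qnum q (n%:Z - i%:Z + 1)).

Definition weight (n i : nat) : F := qh ^ (2 * i%:Z - n%:Z).

Lemma ladder0 n : ladder n 0 = 0.
Proof. by apply/eqP; rewrite sqrt_eq0 /qnum oppr0 subrr !mul0r. Qed.

Lemma ladder_out n : ladder n n.+1 = 0.
Proof.
apply/eqP; rewrite sqrt_eq0; have -> : n%:Z - n.+1%:Z + 1 = 0 by lia.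
by rewrite /qnum oppr0 subrr mul0r mulr0.
Qed.

Lemma ladder_neq0 n i : (0 < i <= n)%N -> ladder n i != 0.
Proof. by move=> ?; rewrite sqrt_eq0 mulf_neq0 ?qnum_neq0 //; lia. Qed.

Lemma weight_neq0 n i : weight n i != 0.
Proof. by rewrite expfz_neq0. Qed.

Lemma weightM_inj n i j k l :
  weight n i * weight n j = weight n k * weight n l -> (i + j = k + l)%N.
Proof.
rewrite /weight -!expfzDr //.
have e u v : (2 * u%:Z - n%:Z) + (2 * v%:Z - n%:Z) = 2 * ((u + v)%:Z - n%:Z).
  by lia.
by rewrite !{}e !expq_double => /expq_inj; lia.
Qed.

Lemma spin_XmE n (i j : 'I_n.+1) :
  spin q qh sqrt n Xm i j = if i.+1 == j :> nat then ladder n j else 0.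
Proof. by rewrite mxE. Qed.

Lemma spin_XpE n (i j : 'I_n.+1) :
  spin q qh sqrt n Xp i j = if i == j.+1 :> nat then ladder n i else 0.
Proof.
(* The radicands for [Xp] and [Xm] differ only in the order of their factors, and [sqrt] is a
   function, so the roots agree. *)
rewrite mxE; case: eqP => // ->; congr (sqrt _).
by rewrite mulrC; congr (_ * _); congr (qnum _ _); lia.
Qed.

Lemma spin_qHE n (i j : 'I_n.+1) :
  spin q qh sqrt n qH i j = if i == j then weight n j else 0.
Proof. by rewrite mxE. Qed.

Lemma spin_qHiE n (i j : 'I_n.+1) :
  spin q qh sqrt n qHi i j = if i == j then (weight n j)^-1 else 0.
Proof. by rewrite mxE /weight invr_expz. Qed.

(** The quantum Casimir element, multiplied by [(q - q^-1) ^+ 2] to clear its denominator. *)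
Definition casimir d (pi : uq_action F d) : 'M[F]_d :=
  (q - q^-1) ^+ 2 *: (pi Xp *m pi Xm) + q^-1 *: (pi qH *m pi qH)
  + q *: (pi qHi *m pi qHi).

Definition casimir_eigen (j : nat) : F := q ^ (j.+1)%:Z + q ^ (- (j.+1)%:Z).

Lemma casimir_mul d (pi : uq_action F d) (v : 'cV_d) : casimir pi *m v =
  (q - q^-1) ^+ 2 *: (pi Xp *m (pi Xm *m v)) + q^-1 *: (pi qH *m (pi qH *m v))
  + q *: (pi qHi *m (pi qHi *m v)).
Proof. by rewrite !mulmxDl -!scalemxAl -!mulmxA. Qed.

(** The diagonal entries amount to [(q - q^-1)^2 [j][n-j+1] + q^(2j-n-1) + q^(n-2j+1) = q^(n+1) +
    q^(-n-1)]. *)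
Lemma casimir_spin n : casimir (spin q qh sqrt n) = (casimir_eigen n)%:M.
Proof.
have XX i j : (spin q qh sqrt n Xp *m spin q qh sqrt n Xm) i j =
    if i == j then ladder n j ^+ 2 else 0.
  rewrite mxE; have [j0|j_gt0] := posnP j.
    rewrite big1 => [|k _]; last by rewrite spin_XmE j0 mulr0.
    by rewrite j0 ladder0 expr0n if_same.
  have jn : (j.-1 < n.+1)%N by have := ltn_ord j; lia.
  rewrite (bigD1 (Ordinal jn)) //= big1 => [|k kj].
    rewrite addr0 spin_XpE spin_XmE /= prednK // eqxx val_eqE.
    by case: eqP => [->|_]; rewrite ?mul0r.
  rewrite spin_XmE; case: eqP => [e|]; last by rewrite mulr0.
  by case/eqP: kj; apply: val_inj; rewrite /= -e.
have diag2 (f : nat -> F) (A : 'M[F]_n.+1) i j :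
    (forall i j, A i j = if i == j then f j else 0) ->
    (A *m A) i j = if i == j then f j ^+ 2 else 0.
  move=> Af; rewrite mxE (bigD1 j) //= big1 => [|k kj].
    by rewrite !Af eqxx addr0; case: eqP => _; rewrite ?mul0r ?expr2.
  by rewrite (Af k) (negPf kj) mulr0.
have DE (A B : 'M[F]_n.+1) i j : (A + B) i j = A i j + B i j by rewrite mxE.
have ZE c (A : 'M[F]_n.+1) i j : (c *: A) i j = c * A i j by rewrite mxE.
apply/matrixP => i j; rewrite /casimir !DE !ZE XX.
rewrite (diag2 (weight n) _ _ _ (@spin_qHE n)).
rewrite (diag2 (fun k => (weight n k)^-1) _ _ _ (@spin_qHiE n)) !mxE.
case: eqP => _; last by rewrite !mulr0 !addr0.
rewrite /ladder sqrtK exprVn !expr2 /weight -expfzDr //.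
have -> : 2 * j%:Z - n%:Z + (2 * j%:Z - n%:Z) = 2 * (j%:Z + j%:Z - n%:Z) by lia.
rewrite expq_double /qnum /casimir_eigen.
rewrite -!invr_expz (_ : (n.+1)%:Z = n%:Z + 1); last lia.
rewrite !expfzDr // -!invr_expz !expr1z.
have := expfz_neq0 j%:Z q_neq0; have := expfz_neq0 n%:Z q_neq0.
move: (q ^ j%:Z) (q ^ n%:Z) => u v v0 u0.
by rewrite mulr1n; field; rewrite v0 u0 q_neq0 -expr2 subr_eq0 q_generic.
Qed.

Lemma uq_hom_gen d e (pi : uq_action F d) (pi' : uq_action F e) f :
  uq_hom pi' pi f -> forall g, f *m pi' g = pi g *m f.
Proof.
move=> hf g; have := hf [:: (1, [:: g])].
by rewrite /act !big_seq1 /= !big_cons !big_nil !mulmx1 !scale1r.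
Qed.

(** Transports the scalar of [casimir_spin] to any submodule isomorphic to a spin module. *)
Lemma casimir_hom d e (pi : uq_action F d) (pi' : uq_action F e) f :
  uq_hom pi' pi f -> casimir pi *m f = f *m casimir pi'.
Proof.
move=> /uq_hom_gen g_hom.
have gg g g' : (pi g *m pi g') *m f = f *m (pi' g *m pi' g').
  by rewrite -mulmxA -g_hom mulmxA -g_hom -mulmxA.
by rewrite /casimir !mulmxDl !mulmxDr -!scalemxAl -!scalemxAr !gg.
Qed.

Lemma casimir_eigen_inj i j : casimir_eigen i = casimir_eigen j -> i = j.
Proof.
rewrite /casimir_eigen -!invr_expz; set y := q ^ _; set z := q ^ _ => E.
have [y0 z0] : y != 0 /\ z != 0 by rewrite !expfz_neq0.
(* The second factor cannot vanish, since [y * z] is a positive power of [q]. *)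
have /eqP : (y - z) * (y * z - 1) = 0.
  have -> : (y - z) * (y * z - 1) = y * z * ((y + y^-1) - (z + z^-1)).
    by field; rewrite y0 z0.
  by rewrite E subrr mulr0.
rewrite mulf_eq0 !subr_eq0 => /orP[] /eqP; first by move/expq_inj; lia.
by rewrite /y /z -expfzDr // -[RHS](expr0z q) => /expq_inj; lia.
Qed.

Lemma spin_XmT n : (spin q qh sqrt n Xm)^T = spin q qh sqrt n Xp.
Proof.
apply/matrixP => i j; rewrite mxE spin_XmE spin_XpE.
by rewrite [X in if X then _ else _]eq_sym.
Qed.

Lemma spin_qHT n : (spin q qh sqrt n qH)^T = spin q qh sqrt n qH.
Proof.
apply/matrixP => i j; rewrite mxE !spin_qHE eq_sym.
by case: eqP => // ->.
Qed.

Lemma spin_qHiT n : (spin q qh sqrt n qHi)^T = spin q qh sqrt n qHi.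
Proof.
apply/matrixP => i j; rewrite mxE !spin_qHiE eq_sym.
by case: eqP => // ->.
Qed.

(** On each factor transposition exchanges [Xm] with [Xp] and fixes [qH] and [qHi]; the coproduct
    has the same shape for [Xm] and [Xp]. *)
Lemma spin2_XmT n : (spin2 q qh sqrt n Xm)^T = spin2 q qh sqrt n Xp.
Proof.
by rewrite /spin2 /tensor linearD /= !trmx_tens spin_XmT spin_qHT spin_qHiT.
Qed.

Lemma casimirT d (pi : uq_action F d) :
  (pi Xm)^T = pi Xp -> (pi qH)^T = pi qH -> (pi qHi)^T = pi qHi ->
  (casimir pi)^T = casimir pi.
Proof.
move=> pT HT HiT; rewrite /casimir !linearD /= !linearZ /= !trmx_mul.
by rewrite HT HiT -pT trmxK.
Qed.

Lemma casimir_spin2T n :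
  (casimir (spin2 q qh sqrt n))^T = casimir (spin2 q qh sqrt n).
Proof.
apply: casimirT; first exact: spin2_XmT.
  by rewrite /spin2 /= trmx_tens spin_qHT.
by rewrite /spin2 /= trmx_tens spin_qHiT.
Qed.

(** * Coordinates on the tensor square and its lowest weight vectors *)

Section Tensor.
Variable n : nat.
Notation I2 a b := (mxtens_index (inord a : 'I_n.+1, inord b : 'I_n.+1)).
Notation x := (ladder n).
Notation kap := (weight n).
Notation pi := (spin2 q qh sqrt n).

Lemma ord_sum1 (V : nmodType) (G : 'I_n.+1 -> V) i :
  (forall j, j != i -> G j = 0) -> \sum_j G j = G i.
Proof. by move=> G0; rewrite (bigD1 i) //= big1 ?addr0. Qed.

Lemma spin_Xm_sum (G : 'I_n.+1 -> F) i : (i <= n)%N ->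
  \sum_j spin q qh sqrt n Xm (inord i) j * G j = x i.+1 * G (inord i.+1).
Proof.
(* At [i = n] the index [inord i.+1] is a default value, and [ladder_out] makes its coefficient
   zero. *)
move=> iN; have [iE|iE] := eqVneq i n.
  rewrite iE ladder_out mul0r big1 // => j _; rewrite spin_XmE inordK //.
  by rewrite gtn_eqF ?mul0r ?ltn_ord.
rewrite (@ord_sum1 _ _ (inord i.+1)) => [|j ji];
  rewrite spin_XmE !inordK ?eqxx //; try lia.
rewrite ifN ?mul0r //; apply: contraNneq ji => e; apply/eqP/val_inj.
by rewrite /= inordK // e.
Qed.

Lemma sum_spin_Xm (G : 'I_n.+1 -> F) j : (j <= n)%N ->
  \sum_i G i * spin q qh sqrt n Xm i (inord j) = x j * G (inord j.-1).
Proof.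
move=> jn; have [->|j0] := posnP j.
  by rewrite ladder0 mul0r big1 // => i _; rewrite spin_XmE inordK // mulr0.
rewrite (@ord_sum1 _ _ (inord j.-1)) => [|i ij];
  rewrite spin_XmE !inordK //; try lia.
  by rewrite prednK // eqxx mulrC.
rewrite ifN ?mulr0 //; apply: contraNneq ij => e; apply/eqP/val_inj.
by rewrite /= inordK -e //= ltnS ltnW // -e.
Qed.

Lemma spin_qH_sum (G : 'I_n.+1 -> F) i : (i <= n)%N ->
  \sum_j spin q qh sqrt n qH (inord i) j * G j = kap i * G (inord i).
Proof.
move=> iN; rewrite (@ord_sum1 _ _ (inord i)) => [|j ji]; rewrite spin_qHE.
  by rewrite eqxx inordK.
by rewrite eq_sym (negPf ji) mul0r.
Qed.

Lemma spin_qHi_sum (G : 'I_n.+1 -> F) i : (i <= n)%N ->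
  \sum_j spin q qh sqrt n qHi (inord i) j * G j = (kap i)^-1 * G (inord i).
Proof.
move=> iN; rewrite (@ord_sum1 _ _ (inord i)) => [|j ji]; rewrite spin_qHiE.
  by rewrite eqxx inordK.
by rewrite eq_sym (negPf ji) mul0r.
Qed.

Lemma sum_spin_qH (G : 'I_n.+1 -> F) j : (j <= n)%N ->
  \sum_i G i * spin q qh sqrt n qH i (inord j) = kap j * G (inord j).
Proof.
move=> jn; rewrite (@ord_sum1 _ _ (inord j)) => [|i ij]; rewrite spin_qHE.
  by rewrite eqxx inordK // mulrC.
by rewrite (negPf ij) mulr0.
Qed.

Lemma sum_spin_qHi (G : 'I_n.+1 -> F) j : (j <= n)%N ->
  \sum_i G i * spin q qh sqrt n qHi i (inord j) = (kap j)^-1 * G (inord j).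
Proof.
move=> jn; rewrite (@ord_sum1 _ _ (inord j)) => [|i ij]; rewrite spin_qHiE.
  by rewrite eqxx inordK // mulrC.
by rewrite (negPf ij) mulr0.
Qed.

Lemma tens_mulmxE p (A B : 'M[F]_n.+1) (M : 'M[F]_(n.+1 * n.+1, p)) a b l :
  (A *t B *m M) (mxtens_index (a, b)) l =
  \sum_i A a i * \sum_j B b j * M (mxtens_index (i, j)) l.
Proof.
rewrite mxE sum_mxtens; apply: eq_bigr => i _; rewrite mulr_sumr.
by apply: eq_bigr => j _; rewrite tensmxE mulrA.
Qed.

Lemma mulmx_tensE p (A B : 'M[F]_n.+1) (M : 'M[F]_(p, n.+1 * n.+1)) a b l :
  (M *m (A *t B)) l (mxtens_index (a, b)) =
  \sum_i (\sum_j M l (mxtens_index (i, j)) * B j b) * A i a.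
Proof.
rewrite mxE sum_mxtens; apply: eq_bigr => i _; rewrite mulr_suml.
by apply: eq_bigr => j _; rewrite tensmxE -mulrA [B _ _ * _]mulrC.
Qed.

Lemma spin2_Xm_mulE p (M : 'M[F]_(n.+1 * n.+1, p)) a b l :
  (a <= n)%N -> (b <= n)%N ->
  (pi Xm *m M) (I2 a b) l =
  x a.+1 / kap b * M (I2 a.+1 b) l + kap a * x b.+1 * M (I2 a b.+1) l.
Proof.
move=> an bn; rewrite /spin2 /tensor mulmxDl mxE !tens_mulmxE.
rewrite spin_Xm_sum // spin_qH_sum //.
rewrite spin_qHi_sum // spin_Xm_sum //.
by rewrite !mulrA.
Qed.

Lemma mul_spin2_XmE p (M : 'M[F]_(p, n.+1 * n.+1)) i j l :
  (i <= n)%N -> (j <= n)%N ->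
  (M *m pi Xm) l (I2 i j) =
  x i / kap j * M l (I2 i.-1 j) + kap i * x j * M l (I2 i j.-1).
Proof.
move=> an bn; rewrite /spin2 /tensor mulmxDr mxE !mulmx_tensE.
rewrite sum_spin_Xm // sum_spin_qH //.
rewrite sum_spin_qHi // sum_spin_Xm //.
by rewrite !mulrA.
Qed.

Lemma spin2_qH_mulE p (M : 'M[F]_(n.+1 * n.+1, p)) a b l :
  (a <= n)%N -> (b <= n)%N ->
  (pi qH *m M) (I2 a b) l = kap a * kap b * M (I2 a b) l.
Proof.
move=> an bn; rewrite /spin2 /tensor !tens_mulmxE.
rewrite spin_qH_sum // spin_qH_sum //.
by rewrite !mulrA.
Qed.

Lemma mul_spin2_qHE p (M : 'M[F]_(p, n.+1 * n.+1)) i j l :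
  (i <= n)%N -> (j <= n)%N ->
  (M *m pi qH) l (I2 i j) = kap i * kap j * M l (I2 i j).
Proof.
move=> an bn; rewrite /spin2 /tensor !mulmx_tensE.
rewrite sum_spin_qH // sum_spin_qH //.
by rewrite !mulrA.
Qed.

Lemma spin2_qHi_mulE p (M : 'M[F]_(n.+1 * n.+1, p)) a b l :
  (a <= n)%N -> (b <= n)%N ->
  (pi qHi *m M) (I2 a b) l = (kap a * kap b)^-1 * M (I2 a b) l.
Proof.
move=> an bn; rewrite /spin2 /tensor !tens_mulmxE.
rewrite spin_qHi_sum // spin_qHi_sum //.
by rewrite !mulrA invfM.
Qed.

(* [lowest k] spans the kernel of [pi Xm] at total level [k] (the recursion
   [lowest_coefS]), i.e. it is the lowest weight vector of the spin [n - k]. *)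
Definition lowest_coef (k a : nat) : F :=
  \prod_(l < a) - (kap l * kap (k - l).-1 * x (k - l) / x l.+1).

Definition lowest (k : nat) : 'cV[F]_(n.+1 * n.+1) :=
  \col_p let: (a, b) := mxtens_unindex p in
    if (a + b == k)%N then lowest_coef k a else 0.

Lemma lowestE k a b l : (a <= n)%N -> (b <= n)%N ->
  lowest k (I2 a b) l = if (a + b == k)%N then lowest_coef k a else 0.
Proof. by move=> an bn; rewrite mxE mxtens_indexK !inordK. Qed.

Lemma lowest_coefS k a : lowest_coef k a.+1 =
  - (kap a * kap (k - a).-1 * x (k - a) / x a.+1) * lowest_coef k a.
Proof. by rewrite /lowest_coef big_ord_recr /= [LHS]mulrC. Qed.

Lemma I2P p : exists a b, [/\ (a <= n)%N, (b <= n)%N & p = I2 a b].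
Proof.
case: (mxtens_indexP p) => a b; exists a, b.
by rewrite !leq_ord !inord_val.
Qed.

Lemma Xm_lowest k : (k <= n)%N -> pi Xm *m lowest k = 0.
Proof.
move=> kn; apply/matrixP => p l; have [a [b [an bn ->]]] := I2P p.
rewrite spin2_Xm_mulE // [RHS]mxE.
(* At [a = n] or [b = n] one term leaves the basis and dies by [ladder_out]; the other, if it stays
   in the basis, lies at a level above [k]. *)
have [an'|an'] := eqVneq a n.
  rewrite an' ladder_out !mul0r add0r; have [->|bn'] := eqVneq b n.
    by rewrite ladder_out mulr0 mul0r.
  rewrite lowestE // ?ifN ?mulr0 //; lia.
have [bn'|bn'] := eqVneq b n.
  by rewrite bn' ladder_out mulr0 mul0r addr0 lowestE // ?ifN ?mulr0 //; lia.
rewrite !lowestE //; try lia.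
rewrite addnS addSn; case: eqP => [e|_]; last by rewrite !mulr0 addr0.
rewrite lowest_coefS (_ : (k - a).-1 = b)%N; last lia.
rewrite (_ : (k - a)%N = b.+1); last lia.
have xa : x a.+1 != 0 by apply: ladder_neq0; lia.
by have := weight_neq0 n b => kb; field; rewrite xa kb.
Qed.

(** The [Xp], [Xm] term vanishes and [q^H] acts by [q^(k - n)]. Through [projector_eigen] the
    eigenvalue singles out the summand [W (n - k)]. *)
Lemma casimir_lowest k : (k <= n)%N ->
  casimir pi *m lowest k = casimir_eigen (n - k).*2 *: lowest k.
Proof.
move=> kn; rewrite casimir_mul Xm_lowest // mulmx0.
rewrite scaler0 add0r; apply/matrixP => p l.
have [a [b [an bn ->]]] := I2P p.
have ZE c (v : 'cV[F]_(n.+1 * n.+1)) r s : (c *: v) r s = c * v r s.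
  by rewrite mxE.
rewrite [LHS]mxE !ZE !spin2_qH_mulE // !spin2_qHi_mulE // lowestE //.
case: eqP => [e|]; last by rewrite !mulr0 addr0.
have -> : kap a * kap b = q ^ (k%:Z - n%:Z).
  by rewrite /weight -expfzDr // -expq_double; congr (_ ^ _); lia.
rewrite !mulrA -mulrDl; congr (_ * _); rewrite addrC; congr (_ + _).
  rewrite !invr_expz -[X in X * _ * _]expr1z -!expfzDr //; congr (_ ^ _); lia.
rewrite -[X in X * _ * _]/(q ^ (- 1)) -!expfzDr //; congr (_ ^ _); lia.
Qed.
End Tensor.
End Spin.

(** * From the braid relation to the eigenvalues *)

Section Uniqueness.
Variables (F : fieldType) (q qh : F) (sqrt : F -> F) (n : nat).
Hypothesis q_neq0 : q != 0.
Hypothesis q_generic : forall m : nat, (0 < m)%N -> q ^+ m != 1.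
Hypothesis qh_sqr : qh ^+ 2 = q.
Hypothesis sqrtK : forall y, sqrt y ^+ 2 = y.
Hypothesis n_gt0 : (0 < n)%N.
Notation I2 a b := (mxtens_index (inord a : 'I_n.+1, inord b : 'I_n.+1)).
Notation x := (ladder q sqrt n).
Notation kap := (weight qh n).
Notation pi := (spin2 q qh sqrt n).
Notation f := (lowest_coef q qh sqrt n).
Variables (T : 'M[F]_(n.+1 * n.+1)) (r : nat -> F).
Hypothesis T_hom : forall g, T *m pi g = pi g *m T.
Hypothesis T_sym : T^T = T.
Hypothesis T_lowest : forall k, (k <= n)%N ->
  T *m lowest q qh sqrt n k = r k *: lowest q qh sqrt n k.
Hypothesis T_braid : yang_baxter T.
Hypothesis r01 : r 1%N != r 0%N.

Let qh_neq0 : qh != 0.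
Proof. exact: qh_neq0 q_neq0 qh_sqr. Qed.

Let kap_neq0 i : kap i != 0.
Proof. exact: weight_neq0 qh_sqr _ _. Qed.

Let x_neq0 i : (0 < i <= n)%N -> x i != 0.
Proof. by move=> ?; exact: ladder_neq0. Qed.

Let t (a b i j : nat) : F := T (I2 a b) (I2 i j).

Let t_sym a b i j : t a b i j = t i j a b.
Proof. by rewrite /t -[in LHS]T_sym mxE. Qed.

Let t_wt a b i j : (a <= n)%N -> (b <= n)%N -> (i <= n)%N ->
  (j <= n)%N -> (a + b != i + j)%N -> t a b i j = 0.
Proof.
move=> an bn iN jn; apply: contraNeq => t0; apply/eqP.
have := congr1 (fun M : 'M_(n.+1 * n.+1) => M (I2 a b) (I2 i j)) (T_hom qH).
rewrite mul_spin2_qHE // spin2_qH_mulE // => /(mulIf t0)/esym.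
exact: (weightM_inj q_neq0 q_generic qh_sqr).
Qed.

Let t_Xm a b i j : (a <= n)%N -> (b <= n)%N -> (i <= n)%N -> (j <= n)%N ->
  x i / kap j * t a b i.-1 j + kap i * x j * t a b i j.-1 =
  x a.+1 / kap b * t a.+1 b i j + kap a * x b.+1 * t a b.+1 i j.
Proof.
move=> an bn iN jn.
have := congr1 (fun M : 'M_(n.+1 * n.+1) => M (I2 a b) (I2 i j)) (T_hom Xm).
by rewrite mul_spin2_XmE // spin2_Xm_mulE.
Qed.

Let t_braid a b c i j k : (a <= n)%N -> (b <= n)%N ->
  (c <= n)%N -> (i <= n)%N -> (j <= n)%N -> (k <= n)%N ->
  \sum_(u < n.+1) \sum_(v < n.+1) \sum_(w < n.+1)
    t u v i j * t w c v k * t a b u w =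
  \sum_(u < n.+1) \sum_(v < n.+1) \sum_(w < n.+1)
    t u v j k * t a w i u * t b c w v.
Proof.
move=> *; have := yang_baxterE (inord a) (inord b) (inord c) (inord i) (inord j)
  (inord k) T_braid.
rewrite /t => E; etransitivity; last (etransitivity; first exact: E).
  by do 3!(apply: eq_bigr => ? _); rewrite !inord_val.
by do 3!(apply: eq_bigr => ? _); rewrite !inord_val.
Qed.

Let t_lowest k a b : (k <= n)%N -> (a + b)%N = k ->
  \sum_(i < k.+1) t a b i (k - i) * f k i = r k * f k a.
Proof.
move=> kn e; have [an bn] : (a <= n)%N /\ (b <= n)%N by lia.
have /matrixP/(_ (I2 a b) 0) := T_lowest kn.
rewrite [RHS]mxE lowestE // e eqxx => <-.
rewrite [RHS]mxE sum_mxtens.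
rewrite (big_ord_widen n.+1 (fun i => t a b i (k - i) * f k i)) //.
rewrite big_mkcond; apply: eq_bigr => i _.
transitivity (\sum_(j < n.+1) t a b i j *
  (if (i + j == k)%N then f k i else 0)).
  case: ltnP => ik; last first.
    by rewrite big1 // => j _; rewrite ifN ?mulr0 //; lia.
  rewrite (@sum_ord_only _ n (fun j => t a b i j *
    (if (i + j == k)%N then f k i else 0)) (k - i)); try lia.
    by rewrite subnKC ?eqxx.
  by move=> j jn ji; rewrite ifN ?mulr0 //; lia.
apply: eq_bigr => j _.
have := @lowestE _ q qh sqrt n k i j 0 (leq_ord i) (leq_ord j).
by rewrite /t !inord_val => ->.
Qed.

Let f0 k : f k 0 = 1.
Proof. by rewrite /lowest_coef big_ord0. Qed.

(** The ladder entries cancel against the same product in reverse order, and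
    [kap l * kap (k - l).-1] does not depend on [l]. *)
Let fk k : (k <= n)%N ->
  f k k = (-1) ^+ k * qh ^ (2 * (k%:Z - 1 - n%:Z) * k%:Z).
Proof.
move=> kn; rewrite /lowest_coef.
transitivity (\prod_(l < k) (- (qh ^ (2 * (k%:Z - 1 - n%:Z)))) *
  \prod_(l < k) (x (k - l) / x l.+1)).
  rewrite -big_split /=; apply: eq_bigr => l _.
  rewrite mulNr !mulrA; congr (- (_ * _ * _)).
  by have := ltn_ord l; rewrite /weight -expfzDr // => ?; congr (_ ^ _); lia.
rewrite big_split /= prodfV.
have -> : \prod_(l < k) x (k - l) = \prod_(l < k) x l.+1.
  rewrite (reindex_inj rev_ord_inj) /=.
  by apply: eq_bigr => l _; congr x; have := ltn_ord l; lia.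
rewrite mulfV ?mulr1; last first.
  by apply/prodf_neq0 => l _; apply: x_neq0; have := ltn_ord l; lia.
by rewrite prodr_const card_ord [in LHS]exprNn -[in RHS]exprz_exp -exprnP.
Qed.

Let t_base : t 1 0 0 1 != 0 /\ (t 0 1 0 1 = 0 \/ t 1 0 1 0 = 0).
Proof.
(* If it vanished, commutation with [X^-] would give [t 0 1 0 1 = t 0 0 0 0]; these would be [r 1]
   and [r 0]. *)
have B0 : t 1 0 0 1 != 0.
  apply: contra_neq r01 => B0.
  have x1 : x 1 != 0 by apply: x_neq0; rewrite n_gt0.
  have A : t 0 1 0 1 = t 0 0 0 0.
    have := t_Xm (leq0n n) (leq0n n) (leq0n n) n_gt0; rewrite ladder0 // B0 /=.
    rewrite !mul0r mulr0 !add0r => E.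
    by apply: (mulfI (mulf_neq0 (kap_neq0 0) x1)); rewrite -E.
  have := t_lowest (leq0n n) (erefl : 0 + 0 = 0)%N.
  rewrite big_ord_recl big_ord0 f0 !mulr1 addr0 /= => <-.
  have := t_lowest n_gt0 (erefl : 0 + 1 = 1)%N.
  rewrite !big_ord_recl big_ord0 f0 !mulr1 addr0 /= => <-.
  by rewrite [t 0 1 1 0]t_sym B0 mul0r addr0 A.
split=> //.
(* Both sides contain [t 0 1 0 1 * t 0 0 0 0 * t 1 0 0 1]; what remains is a single product equal to
   zero. *)
have := @t_braid 0 1 0 0 0 1.
rewrite (@sum_ord_only _ n (fun u => \sum_(v < n.+1) \sum_(w < n.+1)
  t u v 0 0 * t w 0 v 1 * t 0 1 u w) 0) //; last first.
  by move=> u un u0; apply: big1 => v _; apply: big1 => w _;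
    rewrite t_wt ?mul0r ?leq_ord //; lia.
rewrite (@sum_ord_only _ n (fun v => \sum_(w < n.+1)
  t 0 v 0 0 * t w 0 v 1 * t 0 1 0 w) 0) //; last first.
  by move=> v vn v0; apply: big1 => w _; rewrite t_wt ?mul0r ?leq_ord //; lia.
rewrite (@sum_ord_only _ n (fun w => t 0 0 0 0 * t w 0 0 1 * t 0 1 0 w) 1) //;
  last first.
  by move=> w wn w0; rewrite [t w 0 0 1]t_wt ?mulr0 ?mul0r ?leq_ord //; lia.
rewrite (@sum_ord_two _ n (fun u => \sum_(v < n.+1) \sum_(w < n.+1)
  t u v 0 1 * t 0 w 0 u * t 1 0 w v) 0 1) //; last first.
  by move=> u un u0 u1; apply: big1 => v _; apply: big1 => w _;
    rewrite t_wt ?mul0r ?leq_ord //; lia.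
rewrite (@sum_ord_only _ n (fun v => \sum_(w < n.+1)
  t 0 v 0 1 * t 0 w 0 0 * t 1 0 w v) 1) //; last first.
  by move=> v vn v0; apply: big1 => w _; rewrite t_wt ?mul0r ?leq_ord //; lia.
rewrite (@sum_ord_only _ n (fun w => t 0 1 0 1 * t 0 w 0 0 * t 1 0 w 1) 0) //;
  last first.
  by move=> w wn w0; rewrite [t 0 w 0 0]t_wt ?mulr0 ?mul0r ?leq_ord //; lia.
rewrite (@sum_ord_only _ n (fun v => \sum_(w < n.+1)
  t 1 v 0 1 * t 0 w 0 1 * t 1 0 w v) 0) //; last first.
  by move=> v vn v0; apply: big1 => w _; rewrite t_wt ?mul0r ?leq_ord //; lia.
rewrite (@sum_ord_only _ n (fun w => t 1 0 0 1 * t 0 w 0 1 * t 1 0 w 0) 1) //;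
  last first.
  by move=> w wn w0; rewrite [t 0 w 0 1]t_wt ?mulr0 ?mul0r ?leq_ord //; lia.
move=> /(_ _ _ _ _ _ _) E.
have /eqP : t 1 0 0 1 * t 0 1 0 1 * t 1 0 1 0 = 0.
  by apply: (addrI (t 0 1 0 1 * t 0 0 0 0 * t 1 0 0 1)); rewrite -E //; ring.
by rewrite !mulf_eq0 (negPf B0) => /orP[]/eqP; [left|right].
Qed.

Let left_extremal : t 0 1 0 1 = 0 -> forall k a b,
  (k <= n)%N -> (a <= n)%N -> (b <= n)%N ->
  t a b 0 k = if (a == k) && (b == 0) then kap 0 ^+ (2 * k) * t 0 0 0 0 else 0.
Proof.
move=> A; have [t1001 _] := t_base.
apply: (extremal_column n_gt0 x_neq0 kap_neq0 t_wt t_sym _ t_braid A t1001).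
move=> a b j an bn jn.
have := t_Xm (ltnW an) (ltnW bn) (leq0n n) jn.
by rewrite ladder0 // !mul0r add0r.
Qed.

(** Exchanging the tensor factors swaps the two sides of the braid relation and inverts [kap] in the
    coproduct, so [extremal_column] applies to [t b a j i]. *)
Let right_extremal : t 1 0 1 0 = 0 -> forall k a b,
  (k <= n)%N -> (a <= n)%N -> (b <= n)%N ->
  t b a k 0 = if (a == k) && (b == 0) then (kap 0)^-1 ^+ (2 * k) * t 0 0 0 0
              else 0.
Proof.
move=> D; have [t1001 _] := t_base.
apply: (@extremal_column _ n x (fun i => (kap i)^-1)
  (fun a b i j => t b a j i) n_gt0 x_neq0 _ _ _ _ _ D _).
- by move=> i; rewrite invr_neq0.
- by move=> a b i j an bn iN jn ab; rewrite t_wt //; lia.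
- by move=> a b i j; rewrite t_sym.
- move=> a b j an bn jn.
  have := t_Xm (ltnW bn) (ltnW an) jn (leq0n n).
  rewrite ladder0 // mulr0 mul0r addr0 /= invrK => E.
  rewrite [(kap 0)^-1 * _]mulrC E addrC [x a.+1 * _]mulrC.
  by rewrite [(kap a)^-1 * _]mulrC.
- move=> a b c i j k an bn cn iN jn kn.
  have /esym E := t_braid cn bn an kn jn iN.
  transitivity (\sum_(u < n.+1) \sum_(v < n.+1) \sum_(w < n.+1)
      t u v j i * t c w k u * t b a w v).
    by rewrite exchange_big.
  by rewrite E exchange_big.
- by rewrite t_sym.
Qed.

Let xi_neq0 k : xi qh n k != 0.
Proof. by rewrite mulf_neq0 ?signr_eq0 // expfz_neq0. Qed.

(** The exponents of [xi] at [k] and [0] differ by [2k(k-1-2n)]: the part [-2nk] comes from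
    [kap 0 = qh^(-n)] and the rest from [f k k], so the ratio is [kap 0 ^+ (2 * k) * f k k]. *)
Let xiE k : (k <= n)%N -> xi qh n k = xi qh n 0 * ((-1) ^+ k *
  (kap 0 ^+ (2 * k) * qh ^ (2 * (k%:Z - 1 - n%:Z) * k%:Z))).
Proof.
move=> kn; rewrite /xi subn0 expr0 mul1r mulrCA; congr (_ * _).
rewrite /weight exprnP exprz_exp -!expfzDr //; congr (_ ^ _).
have [m ->] : exists m, n = (m + k)%N by exists (n - k)%N; lia.
by rewrite addnK; lia.
Qed.

(** By symmetry the known column is also a row, with one nonzero entry. In the first case row
    [(0, k)] gives [r k = kap 0 ^+ (2 * k) * r 0 * f k k]; in the second, row [(k, 0)] gives
    [r k * f k k = kap 0 ^- (2 * k) * r 0]. By [xiE] the ratio [r k / r 0] is that of [xi] or its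
    inverse. *)
Lemma eigenvalues_dichotomy :
  (forall k, (k <= n)%N -> r k = r 0%N / xi qh n 0 * xi qh n k) \/
  (forall k, (k <= n)%N -> r k = r 0%N * xi qh n 0 / xi qh n k).
Proof.
have r0E : r 0%N = t 0 0 0 0.
  have := t_lowest (leq0n n) (erefl : 0 + 0 = 0)%N.
  by rewrite big_ord_recl big_ord0 f0 !mulr1 addr0.
have [_ [A|D]] := t_base; [left|right] => k kn.
  have tA i : (i <= k)%N -> t 0 k i (k - i) =
      if i == k then kap 0 ^+ (2 * k) * t 0 0 0 0 else 0.
    move=> ik; rewrite t_sym left_extremal //; try lia.
    by congr (if _ then _ else _); lia.
  have := t_lowest kn (add0n k); rewrite f0 mulr1 => <-.
  rewrite (bigD1 ord_max) //= big1 ?addr0; last first.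
    by move=> i ik; rewrite tA ?ifN ?mul0r ?leq_ord.
  rewrite tA // eqxx fk // r0E (xiE kn).
  by have xi0 := xi_neq0 0; field; rewrite xi0.
have := t_lowest kn (addn0 k).
have tD i : (i <= k)%N -> t k 0 i (k - i) =
    if i == 0 then (kap 0)^-1 ^+ (2 * k) * t 0 0 0 0 else 0.
  move=> ik; rewrite t_sym right_extremal //; try lia.
  by congr (if _ then _ else _); lia.
rewrite big_ord_recl big1 ?addr0 => [|i _].
  rewrite tD // f0 mulr1 fk // exprVn => /esym e.
  have s0 : (-1) ^+ k != 0 :> F by rewrite signr_eq0.
  have c0 : kap 0 ^+ (2 * k) != 0 by rewrite expf_neq0.
  have g0 : qh ^ (2 * (k%:Z - 1 - n%:Z) * k%:Z) != 0 by exact: expfz_neq0.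
  apply: (mulIf (mulf_neq0 s0 g0)); rewrite {}e r0E (xiE kn).
  move: (xi_neq0 0) s0 c0 g0.
  move: (xi qh n 0) ((-1) ^+ k) (kap 0 ^+ _) (qh ^ (_ * _)) => h s c g.
  by move=> h0 s0 c0 g0; field; rewrite h0 s0 c0 g0.
by rewrite tD ?ifN ?mul0r ?leq_ord.
Qed.
End Uniqueness.

(** * Reassembling the operator from its eigenvalues *)

Lemma spectral_sumM (F : fieldType) d n (W : nat -> {vspace 'cV[F]_d})
    (P : nat -> 'M[F]_d) (a b : nat -> F) :
  (\sum_(j < n.+1) W j)%VS = fullv -> projectors n W P ->
  (forall k, (k <= n)%N -> a k * b k = 1) ->
  (\sum_(k < n.+1) a k *: P (n - k)%N) *m (\sum_(k < n.+1) b k *: P (n - k)%N)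
  = 1%:M.
Proof.
move=> WT PW ab; rewrite -(projector_sum1 WT PW).
rewrite mulmx_suml [RHS](reindex_inj rev_ord_inj); apply: eq_bigr => i _ /=.
rewrite mulmx_sumr (bigD1 i) //= big1 => [|j ji].
  rewrite addr0 -scalemxAl -scalemxAr scalerA ab ?leq_ord // scale1r subSS.
  by rewrite (projectorM WT PW) ?leq_subr // eqxx.
rewrite -scalemxAl -scalemxAr (projectorM WT PW) ?leq_subr // ifN ?scaler0 //.
apply: contraNneq ji => e; apply/eqP/val_inj => /=.
by have := ltn_ord i; have := ltn_ord j; lia.
Qed.

Theorem proposition1 (R : realType) (q qh : R[i])
  (hq0 : q != 0)
  (hq : forall m : nat, (0 < m)%N -> q ^+ m != 1)
  (hqh : qh ^+ 2 = q)
  (sqrt : R[i] -> R[i])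
  (hsqrt : forall x : R[i], sqrt x ^+ 2 = x)
  (n : nat)
  (hn : (0 < n)%N)
  (W : nat -> {vspace 'cV[R[i]]_(n.+1 * n.+1)})
  (hW : spin2_decomposition q qh sqrt n W)
  (P : nat -> 'M[R[i]]_(n.+1 * n.+1))
  (hP : projectors n W P)
  (r : nat -> R[i])
  (R' : 'M[R[i]]_(n.+1 * n.+1))
  (hinv : uq_invariant (spin2 q qh sqrt n) R')
  (hR' : R' = \sum_(k < n.+1) r k *: P (n - k)%N)
  (hYB : yang_baxter R')
  (hr : r 1%N != r 0%N) :
  exists c : R[i], c != 0 /\
    (R' = c *: Rmatrix qh n P \/ R' = c *: invmx (Rmatrix qh n P)).
Proof.
have [W_spin _ W_full] := hW.
have qh0 := qh_neq0 hq0 hqh.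
have xi0 k : xi qh n k != 0 by rewrite mulf_neq0 ?signr_eq0 // expfz_neq0.
set C := casimir q (spin2 q qh sqrt n).
have C_scalar j v : (j <= n)%N -> v \in W j ->
    C *m v = casimir_eigen q j.*2 *: v.
  move=> jn; have [_ [f [f_hom _ fW]]] := W_spin j jn; move/fW => [u ->].
  rewrite mulmxA (casimir_hom _ f_hom) -mulmxA (casimir_spin hq0 hq hqh hsqrt).
  by rewrite mul_scalar_mx scalemxAr.
have C_inj i j : (i <= n)%N -> (j <= n)%N ->
    casimir_eigen q i.*2 = casimir_eigen q j.*2 -> i = j.
  by move=> _ _ /(casimir_eigen_inj hq0 hq)/double_inj.
have R'_sym : R'^T = R'.
  rewrite hR' linear_sum /=; apply: eq_bigr => k _; rewrite linearZ /=.
  rewrite (projector_sym W_full hP C_scalar C_inj) ?leq_subr //.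
  exact: casimir_spin2T.
have R'_lowest k : (k <= n)%N ->
    R' *m lowest q qh sqrt n k = r k *: lowest q qh sqrt n k.
  move=> kn; have Cv := casimir_lowest hq0 hq hqh hsqrt kn.
  have Pv := projector_eigen W_full hP C_scalar C_inj (leq_subr k n) Cv.
  rewrite hR' mulmx_suml (bigD1 (Ordinal (kn : (k < n.+1)%N))) //=.
  rewrite big1 => [|i ik].
    by rewrite addr0 -scalemxAl Pv ?leq_subr // eqxx.
  rewrite -scalemxAl Pv ?leq_subr // ifN ?scaler0 //.
  apply: contraNneq ik => e; apply/eqP/val_inj => /=.
  by have := ltn_ord i; lia.
have R'_hom := uq_hom_gen hinv.
have dich := eigenvalues_dichotomy hq0 hq hqh hsqrt hn R'_hom R'_sym R'_lowest
  hYB hr.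
(* If [r 0] were zero, either alternative would force [r 1 = 0], against [hr]. *)
have r0 : r 0%N != 0.
  apply: contra_neq hr => r0.
  by case: dich => /(_ 1%N hn) ->; rewrite r0 !mul0r.
case: dich => rE.
  exists (r 0%N / xi qh n 0); split; first by rewrite mulf_neq0 ?invr_eq0.
  left; rewrite hR' scaler_sumr; apply: eq_bigr => k _.
  by rewrite rE ?leq_ord // scalerA.
exists (r 0%N * xi qh n 0); split; first by rewrite mulf_neq0.
(* Inverting each eigenvalue gives a right inverse of [Rmatrix], which for square matrices is the
   inverse. *)
pose S := \sum_(k < n.+1) (xi qh n k)^-1 *: P (n - k)%N.
right; have RS : Rmatrix qh n P *m S = 1%:M.
  apply: (@spectral_sumM _ _ _ _ _ _ (fun k => (xi qh n k)^-1) W_full hP).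
  by move=> k _; rewrite mulfV.
have [uR _] := mulmx1_unit RS.
have -> : invmx (Rmatrix qh n P) = S.
  by rewrite -[LHS]mulmx1 -RS mulmxA mulVmx // mul1mx.
rewrite hR' scaler_sumr; apply: eq_bigr => k _.
by rewrite rE ?leq_ord // scalerA.
Qed.
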